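(* Let $(V,\omega)$ be a vertex operator algebra, and let $\exp(V,\omega)$ denote Zhu's new vertex operator algebra on the vector space $V$, with vertex operator map $Y[v,x]=Y(e^{xL(0)}v,e^x-1)$ for $v\in V$, vacuum vector $\mathbf{1}$, and conformal vector $\omega-\frac{1}{24}c\mathbf{1}$, where $c$ is the central charge. Then for every $n\in\mathbb{N}$, $$A_n(V,\omega)=\widetilde{A}_n(\exp(V,\omega))$$ as associative algebras.
   Context: All vector spaces are over $\mathbb{C}$; $\mathbb{N}=\{0,1,2,\dots\}$. A vertex operator algebra $(V,\omega)$ is a vertex algebra $V$ (vertex operator map $Y$, vacuum $\mathbf{1}$) with a conformal vector $\omega$, $Y(\omega,x)=\sum_nL(n)x^{-n-2}$, satisfying the Virasoro relations of central charge $c$, $L(-1)v=v_{-2}\mathbf{1}$, $V=\bigoplus_{n\in\mathbb{Z}}V_{(n)}$ with $V_{(n)}=\{v:L(0)v=nv\}$ finite-dimensional and zero for $n$ sufficiently negative. $A_n(V,\omega)=V/O_n(V,\omega)$, where $O_n(V,\omega)$ is spanned by $(L(-1)+L(0))V$ and by $u\circ_nv=\mathrm{Res}_x\frac{(1+x)^{\mathrm{wt}\,u+n}}{x^{2n+2}}Y(u,x)v$, with product induced by $$u*_nv=\sum_{k=0}^n(-1)^k\binom{n+k}{n}\mathrm{Res}_xY(u,x)v\frac{(1+x)^{\mathrm{wt}\,u+n}}{x^{n+k+1}}$$ for $u$ homogeneous of weight $\mathrm{wt}\,u$ (extended linearly). For a vertex algebra $K$ with vertex operator map $Y_K$ and $\mathcal{D}_Kv=\lim_{x\to0}\frac{d}{dx}Y_K(v,x)\mathbf{1}$,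 $\widetilde{A}_n(K)=K/\widetilde{O}_n(K)$, where $\widetilde{O}_n(K)$ is the span of $\mathcal{D}_KK$ and of $\mathrm{Res}_x\frac{e^{(n+1)x}}{(e^x-1)^{2n+2}}Y_K(u,x)v$ for $u,v\in K$, with product induced by $$u\tilde{*}_nv=\mathrm{Res}_x\sum_{i=0}^n\binom{-n-1}{i}\frac{e^{(n+1)x}}{(e^x-1)^{i+n+1}}Y_K(u,x)v.$$ Here $1/(e^x-1)^k$ is the inverse of $(e^x-1)^k$ in $\mathbb{C}((x))$. *)

(* Defs.v *)
From HB Require Import structures.
From mathcomp Require Import all_boot all_order all_algebra.
From mathcomp Require Import complex.
From mathcomp Require Import all_classical all_reals.

Set Implicit Arguments.
Unset Strict Implicit.
Unset Printing Implicit Defensive.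

Import Order.TTheory GRing.Theory Num.Theory.
Local Open Scope classical_set_scope.
Local Open Scope ring_scope.
Local Open Scope complex_scope.

(* A doubly infinite family int -> V stands for the series sum_m (g m) x^m.
   All sums below that range over an infinite set are finitely supported for
   the objects of interest (\sum_(i \in A) is the sum over the support, and 0
   by convention if that support is infinite). *)
Section Series.
Variables (R : realType) (V : lmodType R[i]).
Implicit Types (f : int -> R[i]) (g : int -> V).

Definition bounded_below g := exists N : int, forall m, m < N -> g m = 0.

Definition ser_mul f g : int -> V :=
  fun m => \sum_(i \in [set: int]) f i *: g (m - i).

(* multiplication by x^k *)
Definition ser_shift (k : int) g : int -> V := fun m => g (m - k).

Definition ser_deriv g : int -> V := fun m => (m + 1)%:~R *: g (m + 1).

Definition residue g : V := g (-1).

Definition subspace (A : set V) :=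
  A 0 /\ forall (a : R[i]) u v, A u -> A v -> A (a *: u + v).

Definition span (A : set V) : set V := smallest subspace A.

End Series.

Section ScalarSeries.
Variable R : realType.
Notation C := R[i].

Definition ser_one : int -> C := fun m => (m == 0)%:R.

Definition ser_exp (a : C) : int -> C :=
  fun m => if m is Posz i then a ^+ i / i`!%:R else 0.

Definition expm1 : int -> C := fun m => ser_exp 1 m - ser_one m.

Definition ser_pow (f : int -> C) (k : nat) : int -> C :=
  iter k (ser_mul (V := C^o) f) ser_one.

(* the inverse in the field C((x)) *)
Definition ser_inv (f : int -> C) : int -> C :=
  xget (fun=> 0) [set g : int -> C |
    bounded_below (V := C^o) g /\ ser_mul (V := C^o) f g = ser_one].

Definition ser_powz (f : int -> C) (k : int) : int -> C :=
  match k with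
  | Posz i => ser_pow f i
  | Negz i => ser_inv (ser_pow f i.+1)
  end.

Definition binz (a : int) (i : nat) : C :=
  (\prod_(j < i) (a%:~R - j%:R)) / i`!%:R.

(* (1 + x)^a, expanded in nonnegative powers of x *)
Definition onepx_pow (a : int) : int -> C :=
  fun m => if m is Posz i then binz a i else 0.

End ScalarSeries.

(* [mode X u n v] is u_n v, where Y(u,x)v = sum_n (u_n v) x^(-n-1). *)
Record va_data (R : realType) (V : lmodType R[i]) := VaData {
  mode : V -> int -> V -> V;
  vac : V }.

Record voa_data (R : realType) (V : lmodType R[i]) := VoaData {
  voa_va :> va_data V;
  omega : V }.

Section VertexAlgebra.
Variables (R : realType) (V : lmodType R[i]).
Notation C := R[i].

Definition Yser (K : va_data V) (u v : V) : int -> V :=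
  fun m => mode K u (- m - 1) v.

(* component form of the Jacobi identity *)
Definition borcherds_identity (K : va_data V) :=
  forall (u v w : V) (l m n : int),
    \sum_(i \in [set: nat])
      binz R m i *: mode K (mode K u (l + i%:Z) v) (m + n - i%:Z) w
    = \sum_(i \in [set: nat])
        ((-1) ^+ i * binz R l i) *:
          (mode K u (m + l - i%:Z) (mode K v (n + i%:Z) w)
           - (-1) ^ l *: mode K v (n + l - i%:Z) (mode K u (m + i%:Z) w)).

Record is_vertex_algebra (K : va_data V) : Prop := IsVertexAlgebra {
  va_linearl : forall n v (a : C) u1 u2,
    mode K (a *: u1 + u2) n v = a *: mode K u1 n v + mode K u2 n v;
  va_linearr : forall u n (a : C) v1 v2,
    mode K u n (a *: v1 + v2) = a *: mode K u n v1 + mode K u n v2;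
  va_truncation : forall u v, exists N : int,
    forall n, N <= n -> mode K u n v = 0;
  va_vacuum : forall n v, mode K (vac K) n v = if n == -1 then v else 0;
  va_creation : forall v n, 0 <= n -> mode K v n (vac K) = 0;
  va_creation_lim : forall v, mode K v (-1) (vac K) = v;
  va_jacobi : borcherds_identity K }.

Section Conformal.
Variable X : voa_data V.

(* Y(omega,x) = sum_n L(n) x^(-n-2) *)
Definition Lop (n : int) (v : V) : V := mode X (omega X) (n + 1) v.

Definition homogeneous (k : int) (v : V) := Lop 0 v = k%:~R *: v.

Definition is_weight_decomposition (v : V) (f : int -> V) :=
  [/\ finite_set [set k | f k <> 0],
      forall k, homogeneous k (f k)
    & v = \sum_(k \in [set: int]) f k].

(* The sum of the weight spaces is automatically direct, since they are
   eigenspaces of L(0) for distinct eigenvalues. *)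
Record is_voa (c : C) : Prop := IsVoa {
  voa_vertex_algebra : is_vertex_algebra X;
  voa_virasoro : forall (m n : int) v,
    Lop m (Lop n v) - Lop n (Lop m v)
    = (m - n)%:~R *: Lop (m + n) v
      + (if m + n == 0 then ((m ^+ 3 - m)%:~R / 12%:R * c) *: v else 0);
  voa_translation : forall v, Lop (-1) v = mode X v (-2) (vac X);
  voa_grading : forall v, exists f, is_weight_decomposition v f;
  voa_findim : forall k : int, exists s : seq V,
    homogeneous k `<=` span [set` s];
  voa_lower_bound : exists N : int,
    forall k v, k < N -> homogeneous k v -> v = 0 }.

(* the homogeneous components of v *)
Definition weight_component (v : V) : int -> V :=
  xget (fun=> 0) (is_weight_decomposition v).

End Conformal.

End VertexAlgebra.

(* The quotient of V by a subspace O, as the set of cosets of O together with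
   the operations induced from V by acting on representatives.  The induced
   product is the set of all a * b + o; it is a coset as soon as the product
   is compatible with O, see [qmul_class]. *)
Record quotient_algebra (R : realType) (V : lmodType R[i]) := QuotientAlgebra {
  qcarrier : set (set V);
  qadd : set V -> set V -> set V;
  qscale : R[i] -> set V -> set V;
  qmul : set V -> set V -> set V;
  qone : set V }.

Section Quotient.
Variables (R : realType) (V : lmodType R[i]).

Definition qclass (O : set V) (v : V) : set V := [set w | O (w - v)].

Definition quotient_by (O : set V) (mul : V -> V -> V) (one : V)
  : quotient_algebra V :=
  {| qcarrier := range (qclass O);
     qadd := fun A B =>
       \bigcup_(a in A) \bigcup_(b in B) qclass O (a + b);
     qscale := fun k A => \bigcup_(a in A) qclass O (k *: a);
     qmul := fun A B =>
       \bigcup_(a in A) \bigcup_(b in B) qclass O (mul a b);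
     qone := qclass O one |}.

Lemma qmul_class (O : set V) (mul : V -> V -> V) (one u v : V) :
  subspace O ->
  (forall a a' b b', O (a - a') -> O (b - b') -> O (mul a b - mul a' b')) ->
  qmul (quotient_by O mul one) (qclass O u) (qclass O v)
  = qclass O (mul u v).
Proof.
move=> [O0 OD] Omul; apply/seteqP; split => w /=.
  move=> [a Oa [b Ob /= Ow]]; rewrite /qclass /=.
  have := OD 1 _ _ Ow (Omul _ _ _ _ Oa Ob).
  by rewrite scale1r addrA subrK.
by move=> Ow; exists u; rewrite /qclass /= ?subrr//; exists v;
  rewrite /= ?subrr.
Qed.

End Quotient.

Section HigherZhu.
Variables (R : realType) (V : lmodType R[i]).
Notation C := R[i].

Section An.
Variables (X : voa_data V) (n : nat).

(* u o_n v and u *_n v for u homogeneous of weight k *)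
Definition circ_h (k : int) (u v : V) : V :=
  residue (ser_shift (- (2 * n + 2)%:Z)
    (ser_mul (onepx_pow R (k + n%:Z)) (Yser X u v))).

Definition star_h (k : int) (u v : V) : V :=
  \sum_(i < n.+1) ((-1) ^+ i * 'C(n + i, n)%:R) *:
    residue (ser_shift (- (n + i + 1)%:Z)
      (ser_mul (onepx_pow R (k + n%:Z)) (Yser X u v))).

Definition star (u v : V) : V :=
  \sum_(k \in [set: int]) star_h k (weight_component X u k) v.

Definition O_n : set V :=
  span ([set Lop X (-1) v + Lop X 0 v | v in [set: V]] `|`
        [set w | exists k u v, homogeneous X k u /\ w = circ_h k u v]).

Definition A_n : quotient_algebra V := quotient_by O_n star (vac X).

End An.

Section Atilde.
Variables (K : va_data V) (n : nat).

Definition Dop (v : V) : V := ser_deriv (Yser K v (vac K)) 0.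

Definition circ_t (u v : V) : V :=
  residue (ser_mul
    (ser_mul (V := C^o) (ser_exp n.+1%:R)
       (ser_inv (ser_pow (@expm1 R) (2 * n + 2))))
    (Yser K u v)).

Definition star_t (u v : V) : V :=
  residue (ser_mul
    (fun m => \sum_(i < n.+1) binz R (- n.+1%:Z) i *
       ser_mul (V := C^o) (ser_exp n.+1%:R)
         (ser_inv (ser_pow (@expm1 R) (i + n + 1))) m)
    (Yser K u v)).

Definition Otilde_n : set V :=
  span (range Dop `|` [set w | exists u v, w = circ_t u v]).

Definition Atilde_n : quotient_algebra V := quotient_by Otilde_n star_t (vac K).

End Atilde.

(* Coefficient of x^m in Y(e^(x L(0)) u, e^x - 1) v, i.e. in
   sum_(j,k) (x^j / j!) (e^x - 1)^k [y^k]Y(L(0)^j u, y)v; for fixed m only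
   finitely many pairs (j, k) contribute when X is a vertex operator algebra. *)
Definition Yexp (X : voa_data V) (u v : V) : int -> V :=
  fun m => \sum_(p \in [set: nat * int])
    ((p.1`!%:R)^-1 * ser_powz (@expm1 R) p.2 (m - p.1%:Z)) *:
      Yser X (iter p.1 (Lop X 0) u) v p.2.

Definition exp_voa (X : voa_data V) (c : C) : voa_data V :=
  {| voa_va := {| mode := fun u n v => Yexp X u v (- n - 1);
                  vac := vac X |};
     omega := omega X - (c / 24%:R) *: vac X |}.

End HigherZhu.

(* Main.v *)
Require Import Defs.
From HB Require Import structures.
From mathcomp Require Import all_boot all_order all_algebra.
From mathcomp Require Import complex.
From mathcomp Require Import all_classical all_reals.
From mathcomp Require Import zify ring.

Set Implicit Arguments.
Unset Strict Implicit.
Unset Printing Implicit Defensive.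

Import Order.TTheory GRing.Theory Num.Theory.
Local Open Scope classical_set_scope.
Local Open Scope ring_scope.
Local Open Scope complex_scope.

(** Let [u] be homogeneous of weight [k].  Since [e^(x L(0)) u = e^(k x) u],
    Zhu's vertex operator is [Y[u,x]v = e^(k x) Y(u, e^x - 1)v], the result of
    substituting [y = e^x - 1] in [Y(u,y)v] and multiplying by [e^(k x)].  Both
    defining residues of the second algebra then turn into those of the first
    by the change of variable [y = e^x - 1], [dy = e^x dx]:
[[
    Res_x e^((n+1)x) (e^x - 1)^(-q) e^(k x) Y(u, e^x - 1)v
      = Res_y (1 + y)^(k+n) y^(-q) Y(u,y)v.
]]
    So [circ_t] is [circ_h] and [star_t] is [star_h] on homogeneous [u], with
    no correction term.  Moreover the coefficient of [x] in [Y[v,x]1] is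
    [L(-1)v + L(0)v] ([Dop_exp]).  Every vector is a finite sum of homogeneous
    ones and all operations are additive in [u], so the two subspaces agree
    ([O_nE]) and the two products agree already on [V] ([starE]), before
    passing to the quotient.

    The change of variable is needed one coefficient of [Y(u,y)v] at a time,
    where it reads
    [Res_x e^((a+1)x) (e^x - 1)^(-1-i) = binomial(a, i)] ([residue_exp]).
    Writing [e^x = (e^x - 1) + 1] shows that the left side obeys Pascal's
    rule, so that its difference with the right side does not depend on the
    integer [a], by induction on [i].  At [a = 0] the residue is that of
    [e^x (e^x - 1)^(-1-i)], which for [i > 0] is the derivative of a Laurent
    series up to a nonzero factor, and for [i = 0] has the form
    [1/x + (power series)] ([residue_expm1V]).

    These computations take place in the ring [laurent R] of Laurent series,
    whose elements are the doubly infinite families bounded below, multiplied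
    by [ser_mul]; there [e^x - 1] has integer powers, and [ser_inv] and
    [ser_powz] become ring inverse and ring power ([ser_invE], [ser_powzE]). *)

(** * Finitely supported sums over the integers *)

Section FiniteSums.

Lemma fsumT_seq (T : choiceType) (W : nmodType) (s : seq T) (F : T -> W) :
  uniq s -> (forall i, i \notin s -> F i = 0) ->
  \sum_(i \in [set: T]) F i = \sum_(i <- s) F i.
Proof.
move=> us Fs; rewrite (fsbigE s)//; last by move=> i _; exact: Fs.
by apply: eq_bigl => i; rewrite in_setT.
Qed.

(** The integers from [-K] to [K], a common finite range to which all the
    infinite sums of one computation are cut down. *)
Definition window (K : nat) : seq int :=
  [seq k%:Z - K%:Z | k <- iota 0 (2 * K).+1].

Lemma window_uniq K : uniq (window K).
Proof. by rewrite map_inj_uniq ?iota_uniq// => i j; lia. Qed.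

Lemma mem_window K i : (i \in window K) = (- K%:Z <= i <= K%:Z).
Proof.
apply/mapP/idP => [[k]|iK]; first by rewrite mem_iota => /= ? ->; lia.
by exists (absz (i + K%:Z)); rewrite ?mem_iota /=; lia.
Qed.

Lemma fsum_window (W : nmodType) (K : nat) (F : int -> W) :
  (forall i, (i < - K%:Z) || (K%:Z < i) -> F i = 0) ->
  \sum_(i \in [set: int]) F i = \sum_(i <- window K) F i.
Proof.
move=> FK; apply: fsumT_seq => [|i]; first exact: window_uniq.
by rewrite mem_window => iK; apply: FK; lia.
Qed.

End FiniteSums.

(** * The product of a scalar series and a vector series *)

Section SeriesModule.
Variables (R : realType) (V : lmodType R[i]).
Implicit Types (f : int -> R[i]) (g : int -> V).

Definition vanishes_below (N : int) g := forall m, m < N -> g m = 0.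

Lemma vanishes_belowW M N g :
  M <= N -> vanishes_below N g -> vanishes_below M g.
Proof. by move=> MN gN m mM; apply: gN; lia. Qed.

End SeriesModule.

Section SeriesProduct.
Variables (R : realType) (V : lmodType R[i]).
Notation C := R[i].
Implicit Types (f : int -> R[i]) (g : int -> V).

Lemma ser_mul_vanishes M N f g :
  vanishes_below (V := C^o) M f -> vanishes_below N g ->
  vanishes_below (M + N) (ser_mul f g).
Proof.
move=> fM gN m mMN; apply: fsbig1 => i _.
have [iM|Mi] := ltP i M; first by rewrite fM ?scale0r.
by rewrite gN ?scaler0//; lia.
Qed.

Lemma ser_mul_lead M N f g :
  vanishes_below (V := C^o) M f -> vanishes_below N g ->
  ser_mul f g (M + N) = f M *: g N.
Proof.
move=> fM gN; rewrite /ser_mul (fsumT_seq (s := [:: M]))//.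
  by rewrite big_seq1; congr (_ *: g _); lia.
move=> i; rewrite inE => iM.
have [iM'|Mi] := ltP i M; first by rewrite fM ?scale0r.
by rewrite gN ?scaler0//; lia.
Qed.

Lemma ser_mul_window M N K f g m :
  vanishes_below (V := C^o) M f -> vanishes_below N g ->
  - K%:Z <= M -> m - N <= K%:Z ->
  ser_mul f g m = \sum_(i <- window K) f i *: g (m - i).
Proof.
move=> fM gN KM KN; apply: fsum_window => i /orP[iK|iK].
  by rewrite fM ?scale0r//; lia.
by rewrite gN ?scaler0//; lia.
Qed.

Lemma ser_mulE f g m :
  ser_mul f g m = \sum_(i \in [set: int]) f (m - i) *: g i.
Proof.
rewrite /ser_mul (reindex_fsbigT (fun i : int => m - i)).
  by apply: eq_fsbigr => i _; congr (_ *: g _); lia.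
by exists (fun i : int => m - i) => i; lia.
Qed.

Lemma ser_mul1 g : ser_mul (@ser_one R) g = g.
Proof.
apply: funext => m; rewrite /ser_mul (fsumT_seq (s := [:: 0]))//.
  by rewrite big_seq1 /ser_one eqxx scale1r subr0.
by move=> i; rewrite inE /ser_one => /negbTE->; rewrite scale0r.
Qed.

End SeriesProduct.

Section SeriesProductAssoc.
Variables (R : realType) (V : lmodType R[i]).
Notation C := R[i].
Implicit Types (f : int -> R[i]) (g : int -> V).

(** Cut down to a window, both sides are the double sum of
    [f i * f' (k - i) *: g (m - k)] over [i] and [k]; boundedness below of the
    three series makes one window large enough for both. *)
Lemma ser_mulA f f' g :
  bounded_below (V := C^o) f -> bounded_below (V := C^o) f' ->
  bounded_below g ->
  ser_mul f (ser_mul f' g) = ser_mul (ser_mul (V := C^o) f f') g.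
Proof.
move=> [A fA] [B fB] [D gD]; apply: funext => m.
pose K := (absz A + absz B + absz D + absz m)%N.
have fgP := ser_mul_vanishes fB gD.
have ffP := ser_mul_vanishes (V := C^o) fA fB.
rewrite (ser_mul_window (K := K) fA fgP); [|lia|lia].
rewrite (ser_mul_window (K := K) ffP gD); [|lia|lia].
transitivity (\sum_(i <- window K) \sum_(k <- window K)
    (f i * f' (k - i)) *: g (m - k)).
  apply: eq_bigr => i _; have [iA|Ai] := ltP i A.
    by rewrite fA// scale0r big1// => k _; rewrite mul0r scale0r.
  rewrite ser_mulE (reindex_fsbigT (fun k : int => m - k)).
    rewrite (fsum_window (K := K)).
      rewrite scaler_sumr; apply: eq_bigr => k _.
      by rewrite scalerA; congr (f i * f' _ *: _); lia.
    move=> k /orP[kK|kK]; first by rewrite fB ?scale0r//; lia.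
    by rewrite gD ?scaler0//; lia.
  by exists (fun i : int => m - i) => j; lia.
rewrite exchange_big /=; apply: eq_bigr => k _.
have [mk|km] := ltP (m - k) D.
  by rewrite gD// scaler0 big1// => i _; rewrite scaler0.
rewrite (ser_mul_window (V := C^o) (K := K) fA fB) ?scaler_suml//; lia.
Qed.

End SeriesProductAssoc.

Section SeriesProductLinear.
Variables (R : realType) (V : lmodType R[i]).
Notation C := R[i].
Implicit Types (f : int -> R[i]) (g : int -> V).

Lemma bounded_below_lin a g1 g2 :
  bounded_below g1 -> bounded_below g2 ->
  bounded_below (fun m => a *: g1 m + g2 m).
Proof.
move=> [A gA] [B gB]; exists (Num.min A B) => m; rewrite lt_min => /andP[mA mB].
by rewrite gA// gB// scaler0 addr0.
Qed.

Lemma ser_mul_linr f a g1 g2 :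
  bounded_below (V := C^o) f -> bounded_below g1 -> bounded_below g2 ->
  ser_mul f (fun m => a *: g1 m + g2 m)
  = fun m => a *: ser_mul f g1 m + ser_mul f g2 m.
Proof.
move=> [A fA] [B gB] [D gD]; apply: funext => m.
pose K := (absz A + absz B + absz D + absz m)%N.
pose N := Num.min B D.
have gB' : vanishes_below N g1 by apply: vanishes_belowW gB; lia.
have gD' : vanishes_below N g2 by apply: vanishes_belowW gD; lia.
have gN : vanishes_below N (fun m => a *: g1 m + g2 m).
  by move=> j jN; rewrite gB'// gD'// scaler0 addr0.
rewrite !(ser_mul_window (K := K) (M := A) (N := N))//; [|lia..].
rewrite scaler_sumr -big_split /=; apply: eq_bigr => i _.
by rewrite scalerDr !scalerA mulrC.
Qed.

Lemma ser_mul_linl f1 f2 a g :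
  bounded_below (V := C^o) f1 -> bounded_below (V := C^o) f2 ->
  bounded_below g ->
  ser_mul (fun m => a * f1 m + f2 m) g
  = fun m => a *: ser_mul f1 g m + ser_mul f2 g m.
Proof.
move=> [A fA] [B fB] [D gD]; apply: funext => m.
pose K := (absz A + absz B + absz D + absz m)%N.
pose N := Num.min A B.
have fA' : vanishes_below (V := C^o) N f1 by apply: vanishes_belowW fA; lia.
have fB' : vanishes_below (V := C^o) N f2 by apply: vanishes_belowW fB; lia.
have fN : vanishes_below (V := C^o) N (fun m => a * f1 m + f2 m).
  by move=> j jN; rewrite fA'// fB'// mulr0 addr0.
rewrite !(ser_mul_window (K := K) (M := N) (N := D))//; [|lia..].
rewrite scaler_sumr -big_split /=; apply: eq_bigr => i _.
by rewrite scalerDl scalerA.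
Qed.

End SeriesProductLinear.

(** * The ring of Laurent series *)

Section Laurent.
Variable R : realType.
Notation C := R[i].

Record laurent := Laurent {
  coef :> int -> C;
  coefP : `[< bounded_below (V := C^o) coef >] }.

HB.instance Definition _ := [isSub for coef].
HB.instance Definition _ := [Choice of laurent by <:].

Implicit Types f g h : laurent.

Lemma laurent_bounded f : bounded_below (V := C^o) f.
Proof. by case: f => f /= /asboolP. Qed.

Lemma laurentP f g : coef f =1 coef g -> f = g.
Proof. by move=> fg; apply: val_inj; apply: funext. Qed.

Definition laurent_of (f : int -> C) (fb : bounded_below (V := C^o) f) :=
  Laurent (asboolT fb).

Fact bounded0 : bounded_below (V := C^o) (fun=> 0).
Proof. by exists 0. Qed.

Fact boundedN f : bounded_below (V := C^o) (fun m => - f m).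
Proof.
by have [N fN] := laurent_bounded f; exists N => m /fN ->; rewrite oppr0.
Qed.

Fact boundedD f g : bounded_below (V := C^o) (fun m => f m + g m).
Proof.
case: (bounded_below_lin 1 (laurent_bounded f) (laurent_bounded g)) => N fgN.
by exists N => m /fgN; rewrite scale1r.
Qed.

Fact bounded1 : bounded_below (V := C^o) (@ser_one R).
Proof. by exists 0 => m m0; rewrite /ser_one lt_eqF. Qed.

Fact boundedM f g : bounded_below (V := C^o) (ser_mul (V := C^o) f g).
Proof.
case: (laurent_bounded f) (laurent_bounded g) => [M fM] [N gN].
by exists (M + N); exact: ser_mul_vanishes fM gN.
Qed.

Definition laurent0 := laurent_of bounded0.
Definition laurentN f := laurent_of (boundedN f).
Definition laurentD f g := laurent_of (boundedD f g).
Definition laurent1 := laurent_of bounded1.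
Definition laurentM f g := laurent_of (boundedM f g).

Fact laurentDA : associative laurentD.
Proof. by move=> f g h; apply: laurentP => m /=; rewrite addrA. Qed.
Fact laurentDC : commutative laurentD.
Proof. by move=> f g; apply: laurentP => m /=; rewrite addrC. Qed.
Fact laurent0D : left_id laurent0 laurentD.
Proof. by move=> f; apply: laurentP => m /=; rewrite add0r. Qed.
Fact laurentND : left_inverse laurent0 laurentN laurentD.
Proof. by move=> f; apply: laurentP => m /=; rewrite addNr. Qed.

HB.instance Definition _ :=
  GRing.isZmodule.Build laurent laurentDA laurentDC laurent0D laurentND.

Fact laurentMA : associative laurentM.
Proof.
move=> f g h; apply: laurentP => m /=.
by rewrite (ser_mulA (V := C^o)) //; exact: laurent_bounded.
Qed.

Fact laurentMC : commutative laurentM.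
Proof.
move=> f g; apply: laurentP => m /=; rewrite ser_mulE /ser_mul.
by apply: eq_fsbigr => i _; exact: mulrC.
Qed.

Fact laurent1M : left_id laurent1 laurentM.
Proof. by move=> f; apply: laurentP => m /=; rewrite ser_mul1. Qed.

Fact laurentMDl : left_distributive laurentM laurentD.
Proof.
move=> f g h; apply: laurentP => m /=.
have := ser_mul_linl (V := C^o) 1 (laurent_bounded f) (laurent_bounded g)
  (laurent_bounded h).
by under eq_fun do rewrite mul1r; move/(congr1 (@^~ m)); rewrite scale1r.
Qed.

Fact laurent1_neq0 : laurent1 != 0.
Proof.
apply/eqP => /(congr1 (fun f => coef f 0)) /= /eqP.
by rewrite /ser_one eqxx oner_eq0.
Qed.

HB.instance Definition _ := GRing.Zmodule_isComNzRing.Build laurent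
  laurentMA laurentMC laurent1M laurentMDl laurent1_neq0.

(** Units and inverses are specified by choice, which yields the calculus of
    integer powers without deciding which series are invertible; the one series
    needed is inverted in [inv_lead1]. *)
Definition laurent_unit : {pred laurent} :=
  fun f => `[< exists g : laurent, g * f = 1 >].

Definition laurent_inv f : laurent := xget f [set g | g * f = 1].

Fact laurent_mulVf : {in laurent_unit, left_inverse 1 laurent_inv *%R}.
Proof.
by move=> f /asboolP[g gf]; rewrite /laurent_inv; case: xgetP => //= /(_ g).
Qed.

Fact laurent_unitPl f g : g * f = 1 -> laurent_unit f.
Proof. by move=> gf; apply/asboolP; exists g. Qed.

Fact laurent_inv_out : {in [predC laurent_unit], laurent_inv =1 id}.
Proof.
move=> f /negP fN; rewrite /laurent_inv; case: xgetP => //= g _ gf.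
by case: fN; exact: laurent_unitPl gf.
Qed.

HB.instance Definition _ := GRing.ComNzRing_hasMulInverse.Build laurent
  laurent_mulVf laurent_unitPl laurent_inv_out.

Lemma lcoef1 m : (1 : laurent) m = (m == 0)%:R. Proof. by []. Qed.
Lemma lcoefN f m : (- f) m = - f m. Proof. by []. Qed.
Lemma lcoefD f g m : (f + g) m = f m + g m. Proof. by []. Qed.
Lemma lcoefM f g m : (f * g) m = ser_mul (V := C^o) f g m. Proof. by []. Qed.
Lemma lcoef_sum (I : Type) (s : seq I) (F : I -> laurent) m :
  (\sum_(i <- s) F i) m = \sum_(i <- s) F i m.
Proof. by elim/big_rec2: _ => // i x f _ <-. Qed.

Lemma lcoefMn f k m : (f *+ k) m = f m *+ k.
Proof. by elim: k => // k IH; rewrite !mulrS lcoefD IH. Qed.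

End Laurent.

(** * Exponential series and their residues *)

Section ExpSeries.
Variable R : realType.
Notation C := R[i].
Implicit Types f g w : laurent R.

Local Notation order_ge N f := (vanishes_below (V := C^o) N (coef f)).

Lemma order1 : order_ge 0 (1 : laurent R).
Proof. by move=> m m0; rewrite lcoef1 lt_eqF. Qed.

Lemma orderM M N f g : order_ge M f -> order_ge N g -> order_ge (M + N) (f * g).
Proof. exact: ser_mul_vanishes. Qed.

Lemma lcoefM_lead M N f g :
  order_ge M f -> order_ge N g -> (f * g) (M + N) = f M * g N.
Proof. exact: (@ser_mul_lead _ C^o). Qed.

Lemma orderX N f k : order_ge N f -> order_ge (N * k%:Z) (f ^+ k).
Proof.
move=> fN; elim: k => [|k IH]; first by rewrite mulr0; exact: order1.
by rewrite exprS intS mulrDr mulr1; exact: orderM.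
Qed.

(** The geometric series.  Its coefficient at [m] is that of the finite sum
    of the [w ^+ k] for [k <= |m|], since [w ^+ k] starts at degree [k]. *)
Lemma onemw_inv w : order_ge 1 w ->
  exists2 g : laurent R, (1 - w) * g = 1 & order_ge 0 g.
Proof.
move=> w1.
have wk k : order_ge k%:Z (w ^+ k).
  by have := orderX (k := k) w1; rewrite mul1r.
pose s m := \sum_(k < (absz m).+1) (w ^+ k) m.
have s0 : vanishes_below (V := C^o) 0 s.
  by move=> m m0; apply: big1 => k _; apply: wk; lia.
exists (laurent_of (ex_intro _ 0 s0)) => //.
apply: laurentP => m; pose K := (absz m).+1.
set g := laurent_of _; pose p : laurent R := \sum_(k < K) w ^+ k.
have gp : order_ge (m + 1) (g - p).
  (* up to degree m the geometric series is its partial sum p *)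
  move=> j jm; rewrite lcoefD lcoefN lcoef_sum /=; apply/eqP; rewrite subr_eq0.
  apply/eqP; rewrite /s; have [j0|j0] := ltP j 0.
    by rewrite !big1// => k _; apply: wk; lia.
  rewrite -!(big_mkord xpredT (fun k => (w ^+ k) j)).
  rewrite (@big_cat_nat _ _ _ (absz j).+1 0 K)//=; last by rewrite /K; lia.
  rewrite [X in _ = _ + X]big1_seq ?addr0// => k /=.
  by rewrite mem_index_iota => kj; apply: wk; lia.
have w0 : order_ge 0 (1 - w).
  move=> j j0; rewrite lcoefD lcoefN order1// w1 ?subr0//; lia.
have -> : g = p + (g - p) by rewrite addrC subrK.
rewrite mulrDr lcoefD (orderM w0 gp) ?addr0; last by lia.
have -> : (1 - w) * p = 1 - w ^+ K.
  by rewrite -[LHS]opprK -mulNr opprB -subrX1 opprB.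
by rewrite lcoefD lcoefN wk ?subr0// /K; lia.
Qed.

Lemma bounded_monomial (N : int) :
  bounded_below (V := C^o) (fun m => (m == N)%:R).
Proof. by exists N => m mN; rewrite lt_eqF. Qed.

Definition monomial N := laurent_of (bounded_monomial N).

Lemma coef_monomialM N f m : (monomial N * f) m = f (m - N).
Proof.
rewrite lcoefM /ser_mul (fsumT_seq (s := [:: N]))//.
  by rewrite big_seq1 /= eqxx scale1r.
by move=> i; rewrite inE /= => /negbTE->; rewrite scale0r.
Qed.

(** Such an [f] is [x^N (1 - w)] with [w] of positive order. *)
Lemma inv_lead1 N f : order_ge N f -> f N = 1 ->
  f \is a GRing.unit /\ order_ge (- N) (f^-1).
Proof.
move=> fN f1; pose w := 1 - monomial (- N) * f.
have w1 : order_ge 1 w.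
  move=> m m1; rewrite lcoefD lcoefN lcoef1 coef_monomialM opprK.
  have [->|m0] := eqVneq m 0; first by rewrite add0r f1 subrr.
  by rewrite fN ?subr0//; lia.
have [g wg g0] := onemw_inv w1.
have fg : (g * monomial (- N)) * f = 1.
  have wE : monomial (- N) * f = 1 - w by rewrite /w opprB addrC subrK.
  by rewrite -mulrA wE mulrC.
have uf : f \is a GRing.unit by exact: (laurent_unitPl fg).
split=> //; rewrite -[f^-1]mul1r -fg mulrK//.
rewrite -[- N]add0r; apply: orderM => // m mN /=.
by rewrite sub0r lt_eqF.
Qed.

(** The inverse selected by [ser_inv] among bounded families is unique. *)
Lemma ser_invE f : f \is a GRing.unit -> ser_inv f = f^-1 :> (int -> C).
Proof.
move=> uf; rewrite /ser_inv.
have ex : exists g : int -> C,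
    bounded_below (V := C^o) g /\ ser_mul (V := C^o) f g = @ser_one R.
  exists f^-1; split; first exact: laurent_bounded.
  by have /(congr1 (@coef R)) := mulrV uf.
case: xgetP => [g _ [gb fg]|/(_ f^-1)]; last first.
  case; split; first exact: laurent_bounded.
  by have /(congr1 (@coef R)) := mulrV uf.
suff -> : f^-1 = laurent_of gb by [].
apply: (mulrI uf); rewrite mulrV//; apply: laurentP => m.
by rewrite lcoefM fg.
Qed.

Fact bounded_exp (a : C) : bounded_below (V := C^o) (ser_exp a).
Proof. by exists 0; case. Qed.

Definition Lexp a := laurent_of (bounded_exp a).

Lemma order_exp a : order_ge 0 (Lexp a).
Proof. by case. Qed.

(** The binomial theorem, divided by [p!]. *)
Lemma LexpD a b : Lexp (a + b) = Lexp a * Lexp b.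
Proof.
apply: laurentP => -[p|p]; last first.
  rewrite (order_exp (a + b))//.
  by rewrite (orderM (order_exp a) (order_exp b)).
rewrite lcoefM /ser_mul (fsumT_seq (s := [seq k%:Z | k <- iota 0 p.+1])).
- rewrite big_map -[iota _ _]/(index_iota 0 p.+1) big_mkord /=.
  rewrite addrC exprDn mulr_suml; apply: eq_bigr => k _.
  have kp : (k <= p)%N by rewrite -ltnS.
  rewrite subzn//= -(bin_fact kp) natrM -mulr_natr.
  have kf n : n`!%:R != 0 :> C by rewrite pnatr_eq0 -lt0n fact_gt0.
  have kb : 'C(p, k)%:R != 0 :> C by rewrite pnatr_eq0 -lt0n bin_gt0.
  rewrite natrM /GRing.scale /=; field.
  by rewrite !kf kb.
- by rewrite map_inj_uniq ?iota_uniq// => i j; lia.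
- move=> [i|i] iN; last by rewrite /= scale0r.
  rewrite (order_exp b) ?scaler0//.
  have : i \notin iota 0 p.+1 by apply: contra iN => iN; apply: map_f.
  by rewrite mem_iota; lia.
Qed.

Definition Lexpm1 : laurent R := Lexp 1 - 1.

Lemma Lexp1 : Lexp 1 = Lexpm1 + 1. Proof. by rewrite subrK. Qed.

Lemma order_expm1 : order_ge 1 Lexpm1.
Proof.
move=> [[|m]|m] // _; rewrite lcoefD lcoefN lcoef1 /=.
  by rewrite expr0 fact0 divr1 subrr.
by rewrite subr0.
Qed.

Lemma expm1_lead : Lexpm1 1 = 1.
Proof. by rewrite lcoefD lcoefN lcoef1 /= expr1 divr1 subr0. Qed.

Lemma unit_expm1 : Lexpm1 \is a GRing.unit.
Proof. by case: (inv_lead1 order_expm1 expm1_lead). Qed.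

Lemma order_expm1V : order_ge (-1) (Lexpm1^-1).
Proof. by case: (inv_lead1 order_expm1 expm1_lead). Qed.

Lemma order_expm1z (p : int) : order_ge p (Lexpm1 ^ p).
Proof.
case: p => k; first by have := orderX (k := k) order_expm1; rewrite mul1r.
have := orderX (k := k.+1) order_expm1V.
by rewrite mulN1r exprVn NegzE.
Qed.

Lemma ser_powE k : ser_pow (@expm1 R) k = Lexpm1 ^+ k.
Proof.
elim: k => [|k IH]; first by rewrite expr0.
by rewrite exprS /ser_pow iterS -/(ser_pow _ _) IH.
Qed.

Lemma ser_inv_powE k : ser_inv (ser_pow (@expm1 R) k) = Lexpm1 ^ (- k%:Z).
Proof. by rewrite ser_powE ser_invE ?unitrX ?unit_expm1// -exprnN. Qed.

Lemma ser_powzE p : ser_powz (@expm1 R) p = Lexpm1 ^ p.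
Proof. by case: p => k; rewrite /ser_powz ?ser_inv_powE ?ser_powE// NegzE. Qed.

Fact bounded_deriv f :
  bounded_below (V := C^o) (ser_deriv (V := C^o) f).
Proof.
case: (laurent_bounded f) => N fN; exists (N - 1) => m mN.
by rewrite /ser_deriv fN ?scaler0//; lia.
Qed.

Definition lderiv f := laurent_of (bounded_deriv f).

Lemma lcoef_deriv f m : lderiv f m = (m + 1)%:~R * f (m + 1).
Proof. by []. Qed.

Lemma residue_deriv f : lderiv f (-1) = 0.
Proof. by rewrite /= /ser_deriv addNr scale0r. Qed.

Lemma derivM f g : lderiv (f * g) = lderiv f * g + f * lderiv g.
Proof.
apply: laurentP => m; rewrite lcoefD /= /ser_deriv.
have [M fM] := laurent_bounded f; have [N gN] := laurent_bounded g.
pose K := (absz M + absz N + absz m + 1)%N.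
have fg : order_ge (M + N) (f * g) by exact: orderM.
rewrite (ser_mul_window (K := K) fM gN); [|lia|lia].
have dfM : order_ge (M - 1) (lderiv f).
  by move=> j jM; rewrite /= /ser_deriv fM ?scaler0//; lia.
have dgN : order_ge (N - 1) (lderiv g).
  by move=> j jN; rewrite /= /ser_deriv gN ?scaler0//; lia.
rewrite (ser_mul_window (K := K) fM dgN); [|lia|lia].
rewrite /ser_mul (reindex_fsbigT (fun i : int => i - 1)); last first.
  by exists (fun i : int => i + 1) => i; lia.
rewrite (fsum_window (K := K)); last first.
  move=> i /orP[iK|iK].
    by rewrite /= /ser_deriv fM ?scaler0 ?scale0r//; lia.
  by rewrite gN ?scaler0//; lia.
rewrite scaler_sumr -big_split /=; apply: eq_bigr => i _.
rewrite /ser_deriv subrK /GRing.scale /=.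
have -> : m - (i - 1) = m - i + 1 by lia.
have -> : m + 1 - i = m - i + 1 by lia.
have -> : m + 1 = i + (m - i + 1) by lia.
rewrite intrD; ring.
Qed.

Lemma derivX f k : lderiv (f ^+ k.+1) = (lderiv f * f ^+ k) *+ k.+1.
Proof.
elim: k => [|k IH]; first by rewrite expr1 expr0 mulr1 mulr1n.
by rewrite exprS derivM IH mulrnAr mulrCA -exprS [RHS]mulrS.
Qed.

Lemma deriv_expm1 : lderiv Lexpm1 = Lexp 1.
Proof.
apply: laurentP => m; rewrite lcoef_deriv lcoefD lcoefN lcoef1 /=.
case: m => [m|[|m]].
- rewrite -PoszD addn1 /= subr0 !expr1n factS natrM.
  have mf : m`!%:R != 0 :> C by rewrite pnatr_eq0 -lt0n fact_gt0.
  have m1 : 1 + m%:R != 0 :> C by rewrite nat1r pnatr_eq0.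
  rewrite -[m.+1%:~R]/(m.+1%:R); field; by rewrite ?m1 ?m2 ?mf.
- by rewrite mul0r.
- have -> : Negz m.+1 + 1 = Negz m by lia.
  by rewrite subr0 mulr0.
Qed.

Lemma deriv_expm1V : lderiv Lexpm1^-1 = - (Lexp 1 * Lexpm1^-1 ^+ 2).
Proof.
have := derivM Lexpm1 Lexpm1^-1; rewrite mulrV ?unit_expm1// deriv_expm1.
have -> : lderiv 1 = 0.
  apply: laurentP => m; rewrite /= /ser_deriv /ser_one.
  by case: eqP => [->|]; rewrite ?scale0r ?scaler0.
move/esym/eqP; rewrite addrC addr_eq0 => /eqP eqd.
apply: (mulrI unit_expm1); rewrite eqd mulrN; congr (- _).
by rewrite expr2 mulrCA (mulVKr unit_expm1).
Qed.

(** For [k > 0], [e^x (e^x - 1)^(-k-1)] is the derivative of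
    [(e^x - 1)^(-k)] divided by [-k], and derivatives have no residue.  For
    [k = 0] the series is [1 + (e^x - 1)^-1], and the product of [e^x - 1] by
    its inverse gives the leading coefficient of the latter. *)
Lemma residue_expm1V k :
  (Lexp 1 * Lexpm1^-1 ^+ k.+1) (-1) = (k == 0%N)%:R.
Proof.
case: k => [|k].
  rewrite expr1 Lexp1 mulrDl mulrV ?unit_expm1// mul1r lcoefD lcoef1 add0r.
  have := lcoefM_lead order_expm1 order_expm1V.
  by rewrite mulrV ?unit_expm1// expm1_lead mul1r => <-.
have := residue_deriv (Lexpm1^-1 ^+ k.+1).
rewrite derivX deriv_expm1V mulNr -mulrA -exprD lcoefMn lcoefN => /eqP.
by rewrite mulrn_eq0 /= oppr_eq0 => /eqP.
Qed.

Lemma binz0 a : binz R a 0 = 1.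
Proof. by rewrite /binz big_ord0 fact0 divr1. Qed.

Lemma binzS a k : binz R a k.+1 = binz R a k * (a%:~R - k%:R) / k.+1%:R.
Proof.
rewrite /binz big_ord_recr /= factS natrM.
have mf : k`!%:R != 0 :> C by rewrite pnatr_eq0 -lt0n fact_gt0.
have m1 : 1 + k%:R != 0 :> C by rewrite nat1r pnatr_eq0.
field; by rewrite ?m1 ?m2 ?mf.
Qed.

Lemma binz_pascal a k : binz R (a + 1) k.+1 = binz R a k.+1 + binz R a k.
Proof.
elim: k => [|k IH]; first by rewrite !binzS !binz0 intrD; field.
rewrite binzS IH (binzS a k.+1) intrD !(binzS a k).
have m1 : 1 + k%:R != 0 :> C by rewrite nat1r pnatr_eq0.
have m2 : 2 + k%:R != 0 :> C by rewrite -natrD pnatr_eq0.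
field; by rewrite ?m1 ?m2 ?mf.
Qed.

Lemma LexpSr (a : int) : Lexp (a + 1)%:~R = Lexp a%:~R * Lexpm1 + Lexp a%:~R.
Proof. by rewrite intrD LexpD Lexp1 mulrDr mulr1. Qed.

(** Both sides satisfy Pascal's rule in [(a, k)], so by induction on [k] their
    difference is constant in [a]; it vanishes at [a = 0]. *)
Lemma residue_exp_nat (a : int) k :
  (Lexp (a + 1)%:~R * Lexpm1^-1 ^+ k.+1) (-1) = binz R a k.
Proof.
elim: k a => [|k IH] a.
  have step (b : int) : (Lexp (b + 1 + 1)%:~R * Lexpm1^-1 ^+ 1) (-1) =
      (Lexp (b + 1)%:~R * Lexpm1^-1 ^+ 1) (-1).
    rewrite LexpSr mulrDl expr1 mulrK ?unit_expm1// lcoefD.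
    by rewrite (order_exp _) ?add0r.
  rewrite binz0; elim/int_ind: a => [|a IHa|a IHa].
  - by rewrite residue_expm1V.
  - have -> : a.+1%:Z = a%:Z + 1 by lia.
    by rewrite step.
  - have ea : - a%:Z = - a.+1%:Z + 1 by lia.
    by move: IHa; rewrite ea step.
have step (b : int) : (Lexp (b + 1 + 1)%:~R * Lexpm1^-1 ^+ k.+2) (-1) =
    binz R b k + (Lexp (b + 1)%:~R * Lexpm1^-1 ^+ k.+2) (-1).
  rewrite LexpSr mulrDl lcoefD exprS mulrA mulrK ?unit_expm1//.
  by rewrite IH.
elim/int_ind: a => [|a IHa|a IHa].
- by rewrite residue_expm1V /binz big_ord_recl /= subrr !mul0r.
- have -> : (a.+1%:Z = a%:Z + 1) by lia.
  by rewrite step IHa binz_pascal addrC.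
- have ea : - a%:Z = - a.+1%:Z + 1 by lia.
  by move: IHa; rewrite ea step binz_pascal addrC => /addIr->.
Qed.

(** The coefficientwise form of the change of variable [y = e^x - 1]: for
    negative [i] no pole is left and both sides vanish. *)
Lemma residue_exp (a i : int) :
  (Lexp (a + 1)%:~R * Lexpm1 ^ (- 1 - i)) (-1) = onepx_pow R a i.
Proof.
case: i => [k|k]; rewrite [RHS]/=.
  have -> : - 1 - k%:Z = - k.+1%:Z by lia.
  by rewrite -residue_exp_nat -exprnN -exprVn.
rewrite (orderM (order_exp _) (@order_expm1z _))//; lia.
Qed.

End ExpSeries.

(** * Substituting [e^x - 1] in a series with vector coefficients *)

Section Substitution.
Variables (R : realType) (V : lmodType R[i]).
Notation C := R[i].
Implicit Types (A H : laurent R) (g : int -> V).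

Local Notation order_ge N f := (vanishes_below (V := C^o) N (coef f)).
Local Notation E := (Lexpm1 R).

(** The series [A(x) g(e^x - 1)]. *)
Definition subst A g : int -> V :=
  fun m => \sum_(p \in [set: int]) (A * E ^ p) m *: g p.

Lemma order_subst M A p : order_ge M A -> order_ge (M + p) (A * E ^ p).
Proof. by move=> AM; apply: orderM => //; exact: order_expm1z. Qed.

Lemma subst_window M N K A g m :
  order_ge M A -> vanishes_below N g -> - K%:Z <= N -> m - M <= K%:Z ->
  subst A g m = \sum_(p <- window K) (A * E ^ p) m *: g p.
Proof.
move=> AM gN KN KM; apply: fsum_window => p /orP[pK|pK].
  by rewrite gN ?scaler0//; lia.
by rewrite (order_subst (p := p) AM) ?scale0r//; lia.
Qed.

Lemma subst_vanishes M N A g :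
  order_ge M A -> vanishes_below N g -> vanishes_below (M + N) (subst A g).
Proof.
move=> AM gN m mMN; apply: fsbig1 => p _.
have [pN|Np] := ltP p N; first by rewrite gN// scaler0.
by rewrite (order_subst (p := p) AM) ?scale0r//; lia.
Qed.

(** This is associativity of the product, applied to [H], [A] and each power
    of [e^x - 1]; it lets a residue kernel be absorbed in the factor [A]. *)
Lemma ser_mul_subst H A g :
  bounded_below g -> ser_mul H (subst A g) = subst (H * A) g.
Proof.
move=> [N gN]; have [h Hh] := laurent_bounded H.
have [a Aa] := laurent_bounded A; apply: funext => m.
pose K := (absz N + absz h + absz a + absz m)%N.
rewrite (ser_mul_window (K := K) Hh (subst_vanishes Aa gN)); [|lia|lia].
rewrite (subst_window (K := K) (orderM Hh Aa) gN); [|lia|lia].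
transitivity (\sum_(i <- window K) \sum_(p <- window K)
    (H i * (A * E ^ p) (m - i)) *: g p).
  apply: eq_bigr => i _; have [ih|hi] := ltP i h.
    by rewrite Hh// scale0r big1// => p _; rewrite mul0r scale0r.
  rewrite (subst_window (K := K) Aa gN); [|lia|lia].
  by rewrite scaler_sumr; apply: eq_bigr => p _; rewrite scalerA.
rewrite exchange_big; apply: eq_bigr => p _.
have [pN|Np] := ltP p N.
  by rewrite gN// scaler0 big1// => i _; rewrite scaler0.
rewrite -scaler_suml -mulrA lcoefM; congr (_ *: _); apply/esym.
rewrite (ser_mul_window (K := K) Hh (order_subst (p := p) Aa)); [|lia|lia].
by [].
Qed.

(** Change of variable in a residue: [e^((a+1)x) dx] becomes [(1+y)^a dy]. *)
Lemma residue_subst (a q : int) g :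
  residue (subst (Lexp (a + 1)%:~R * E ^ (- q)) g)
  = residue (ser_shift (- q) (ser_mul (onepx_pow R a) g)).
Proof.
rewrite /residue /subst /ser_shift /ser_mul.
rewrite (reindex_fsbigT (fun i : int => - 1 - - q - i)).
  apply: eq_fsbigr => i _; congr (_ *: _).
  rewrite -mulrA -exprzDr ?unit_expm1// -residue_exp.
  by have -> : - q + (- 1 - - q - i) = - 1 - i by lia.
by exists (fun i : int => - 1 - - q - i) => i; lia.
Qed.

Lemma ser_mul_suml n (b : nat -> C) (F : nat -> laurent R) g m :
  bounded_below g ->
  ser_mul (fun j => \sum_(i < n) b i * F i j) g m
  = \sum_(i < n) b i *: ser_mul (F i) g m.
Proof.
move=> gb; elim: n => [|n IH].
  by rewrite big_ord0 /ser_mul fsbig1// => i _; rewrite big_ord0 scale0r.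
have Pb : bounded_below (V := C^o) (fun j => \sum_(i < n) b i * F i j).
  elim: n {IH} => [|n [N IH]]; first by exists 0 => j _; rewrite big_ord0.
  have [M FM] := laurent_bounded (F n); exists (Num.min M N) => j jMN.
  by rewrite big_ord_recr /= FM ?IH ?mulr0 ?addr0//; lia.
have -> : (fun j => \sum_(i < n.+1) b i * F i j)
    = (fun j => b n * F n j + \sum_(i < n) b i * F i j).
  by apply: funext => j; rewrite big_ord_recr addrC.
by rewrite ser_mul_linl ?IH ?big_ord_recr 1?addrC//; exact: laurent_bounded.
Qed.

(** Upper negation turns the binomial coefficients of [star_t] into those of
    [star_h]; by symmetry ['C(n + i, n)] is ['C(n + i, i)]. *)
Lemma binz_opp n i :
  binz R (- n.+1%:Z) i = (-1) ^+ i * 'C(n + i, n)%:R.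
Proof.
elim: i => [|i IH]; first by rewrite binz0 addn0 binn expr0 mul1r.
rewrite binzS IH exprS.
have := mul_bin_diag (n + i).+1 i; rewrite /= -addnS.
rewrite -!(bin_sub (leq_addl _ _)) !addnK => /(congr1 (fun x => x%:R : C)).
rewrite !natrM => eqC; have i0 : i.+1%:R != 0 :> C by rewrite pnatr_eq0.
apply: (mulIf i0); rewrite divfK// -[RHS]mulrA [in RHS](mulrC _ i.+1%:R) -eqC.
rewrite intrN -[n.+1%:~R]/(n.+1%:R) addnS -addSn natrD; ring.
Qed.

End Substitution.

Lemma lin_scale (R : pzRingType) (U W : lmodType R) (f : U -> W) :
  (forall a u1 u2, f (a *: u1 + u2) = a *: f u1 + f u2) ->
  forall a u, f (a *: u) = a *: f u.
Proof.
move=> flin a u; suff f0 : f 0 = 0 by rewrite -[a *: u]addr0 flin f0 addr0.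
by apply: (@addrI _ (1 *: f 0)); rewrite -flin scale1r !addr0 scale1r.
Qed.

(** * Zhu's vertex operator and the two families of residues *)

Section VertexOperatorAlgebra.
Variables (R : realType) (V : lmodType R[i]) (X : voa_data V) (c : R[i]).
Hypothesis hX : is_voa X c.
Notation C := R[i].

Local Notation E := (Lexpm1 R).
Local Notation L0 := (Lop X 0).

Let hV := voa_vertex_algebra hX.

Lemma Yser_lin a u1 u2 v m :
  Yser X (a *: u1 + u2) v m = a *: Yser X u1 v m + Yser X u2 v m.
Proof. exact: va_linearl. Qed.

Lemma YserZ a u v m : Yser X (a *: u) v m = a *: Yser X u v m.
Proof.
by apply: (lin_scale (f := fun u => Yser X u v m)) => b u1 u2; exact: Yser_lin.
Qed.

Lemma Lop_lin m a v1 v2 : Lop X m (a *: v1 + v2) = a *: Lop X m v1 + Lop X m v2.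
Proof. exact: va_linearr. Qed.

Lemma iter_L0_lin j a v1 v2 :
  iter j L0 (a *: v1 + v2) = a *: iter j L0 v1 + iter j L0 v2.
Proof. by elim: j => //= j ->; rewrite Lop_lin. Qed.

Lemma L0Z a v : L0 (a *: v) = a *: L0 v.
Proof. by apply: lin_scale => b v1 v2; exact: Lop_lin. Qed.

Lemma iter_L0_homogeneous j k u :
  homogeneous X k u -> iter j L0 u = (k%:~R ^+ j) *: u.
Proof.
move=> uk; elim: j => [|j /= ->]; first by rewrite scale1r.
by rewrite L0Z uk scalerA -exprSr.
Qed.

Lemma homogeneous0 k : homogeneous X k 0.
Proof.
by rewrite /homogeneous -[X in Lop _ _ X](scale0r 0) L0Z scale0r scaler0.
Qed.

Lemma Yser_bounded u v : bounded_below (Yser X u v).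
Proof.
have [N uN] := va_truncation hV u v; exists (- N) => m mN.
by apply: uN; lia.
Qed.

(** The grading as an induction principle: an additive statement need only be
    checked on homogeneous vectors. *)
Lemma weight_ind (P : V -> Prop) :
  (forall k u, homogeneous X k u -> P u) ->
  (forall u1 u2, P u1 -> P u2 -> P (u1 + u2)) ->
  forall u, P u.
Proof.
move=> Ph PD u; have [f [_ fh ->]] := voa_grading hX u.
apply: big_ind => //; first exact: Ph (homogeneous0 0).
by move=> k _; exact: Ph (fh k).
Qed.

(** A single lower bound for all the series [Y(L(0)^j u, y)v]; it makes the
    double sum defining each coefficient of [Y[u,x]v] finite. *)
Definition Y_bound u v N :=
  forall j, vanishes_below N (Yser X (iter j L0 u) v).

Lemma Y_boundE u v : exists N, Y_bound u v N.
Proof.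
elim/weight_ind: u => [k u uk|u1 u2 [M uM] [N uN]].
  have [N uN] := Yser_bounded u v; exists N => j m mN.
  by rewrite (iter_L0_homogeneous _ uk) YserZ uN// scaler0.
exists (Num.min M N) => j m; rewrite lt_min => /andP[mM mN].
by rewrite -[u1]scale1r iter_L0_lin Yser_lin uM// uN// scaler0 addr0.
Qed.

Lemma Yexp_window u v N K m : Y_bound u v N ->
  (absz N + absz m <= K)%N ->
  Yexp X u v m = \sum_(j <- iota 0 K.+1) \sum_(p <- window K)
    ((j`!%:R)^-1 * (E ^ p) (m - j%:Z)) *: Yser X (iter j L0 u) v p.
Proof.
move=> uN NK; rewrite /Yexp.
rewrite (fsumT_seq (s := [seq (j, p) | j <- iota 0 K.+1, p <- window K])).
- rewrite big_allpairs /=; apply: eq_bigr => j _; apply: eq_bigr => p _.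
  by rewrite ser_powzE.
- by rewrite allpairs_uniq ?iota_uniq ?window_uniq// => -[? ?] [].
- move=> [j p] jp /=; have [pN|Np] := ltP p N; first by rewrite uN ?scaler0.
  rewrite ser_powzE (@order_expm1z _ p) ?mulr0 ?scale0r//.
  rewrite ltNge; apply: contra jp => pj; apply: allpairs_f.
    by rewrite mem_iota; lia.
  by rewrite mem_window; lia.
Qed.

Lemma Yexp_bound u v N : Y_bound u v N -> vanishes_below N (Yexp X u v).
Proof.
move=> uN m mN; apply: fsbig1 => -[j p] _ /=.
have [pN|Np] := ltP p N; first by rewrite uN ?scaler0.
by rewrite ser_powzE (@order_expm1z _ p) ?mulr0 ?scale0r//; lia.
Qed.

Lemma Yexp_bounded u v : bounded_below (Yexp X u v).
Proof. by have [N uN] := Y_boundE u v; exists N; exact: Yexp_bound. Qed.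

Lemma Yexp_lin a u1 u2 v :
  Yexp X (a *: u1 + u2) v = fun m => a *: Yexp X u1 v m + Yexp X u2 v m.
Proof.
apply: funext => m.
have [N1 uN1] := Y_boundE u1 v; have [N2 uN2] := Y_boundE u2 v.
have [N3 uN3] := Y_boundE (a *: u1 + u2) v.
pose K := (absz N1 + absz N2 + absz N3 + absz m)%N.
rewrite (Yexp_window (K := K) uN1); last by lia.
rewrite (Yexp_window (K := K) uN2); last by lia.
rewrite (Yexp_window (K := K) uN3); last by lia.
rewrite scaler_sumr -big_split /=; apply: eq_bigr => j _.
rewrite scaler_sumr -big_split /=; apply: eq_bigr => p _.
by rewrite iter_L0_lin Yser_lin scalerDr !scalerA mulrC.
Qed.

(** [Y[u,x]v = e^(k x) Y(u, e^x - 1)v]: as [L(0)^j u = k^j u], the sum over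
    [j] in the definition of [Y[u,x]v] is the exponential series. *)
Lemma Yexp_homogeneous k u v :
  homogeneous X k u -> Yexp X u v = subst (Lexp k%:~R) (Yser X u v).
Proof.
move=> uk; apply: funext => m.
have [N uN] := Y_boundE u v.
pose K := (absz N + absz m)%N.
rewrite (Yexp_window (K := K) uN); last by lia.
rewrite (subst_window (K := K) (@order_exp _ _) (uN 0%N)); [|lia|lia].
rewrite exchange_big; apply: eq_bigr => p _.
have [pN|Np] := ltP p N.
  rewrite (uN 0%N)// scaler0 big1// => j _.
  by rewrite uN// scaler0.
transitivity (\sum_(j <- iota 0 K.+1)
  (k%:~R ^+ j / j`!%:R * (E ^ p) (m - j%:Z)) *: Yser X u v p).
  apply: eq_bigr => j _; rewrite (iter_L0_homogeneous _ uk) YserZ scalerA.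
  by congr (_ *: _); rewrite mulrC mulrA.
rewrite -scaler_suml; congr (_ *: _); rewrite lcoefM /ser_mul.
rewrite (fsumT_seq (s := [seq j%:Z | j <- iota 0 K.+1])).
- by rewrite big_map.
- by rewrite map_inj_uniq ?iota_uniq// => i j; lia.
- move=> [i|i] iN; last by rewrite /= scale0r.
  rewrite (@order_expm1z _ p) ?scaler0//.
  have : i \notin iota 0 K.+1 by apply: contra iN => iN; apply: map_f.
  by rewrite mem_iota; lia.
Qed.

Lemma Yser_exp u v : Yser (exp_voa X c) u v = Yexp X u v.
Proof. by apply: funext => m; rewrite /Yser /=; congr (Yexp X u v _); lia. Qed.

Section Products.
Variable n : nat.
Let K := exp_voa X c.

(** [e^((n+1)x) (e^x - 1)^(-q)], the form of every residue kernel defining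
    the second algebra. *)
Definition zhu_kernel (q : nat) : laurent R := Lexp n.+1%:R * E ^ (- q%:Z).

(** The factor [e^(k x)] of [Y[u,x]v] combines with [e^((n+1)x)] into
    [e^((k+n+1)x)], and the change of variable applies with [a = k + n]. *)
Lemma residue_kernel q k u v : homogeneous X k u ->
  residue (ser_mul (zhu_kernel q) (Yexp X u v))
  = residue (ser_shift (- q%:Z)
      (ser_mul (onepx_pow R (k + n%:Z)) (Yser X u v))).
Proof.
move=> uk; rewrite (Yexp_homogeneous v uk).
rewrite ser_mul_subst; last exact: Yser_bounded.
have ek : n.+1%:R + k%:~R = (k + n%:Z + 1)%:~R :> C.
  have -> : k + n%:Z + 1 = n.+1%:Z + k by lia.
  by rewrite intrD.
by rewrite /zhu_kernel mulrAC -LexpD ek residue_subst.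
Qed.

Lemma kernelE q : ser_mul (V := C^o) (ser_exp n.+1%:R)
  (ser_inv (ser_pow (@expm1 R) q)) = zhu_kernel q.
Proof. by rewrite ser_inv_powE. Qed.

Lemma circ_tE u v : circ_t K n u v =
  residue (ser_mul (zhu_kernel (2 * n + 2)) (Yexp X u v)).
Proof. by rewrite /circ_t Yser_exp kernelE. Qed.

Lemma star_tE u v : star_t K n u v =
  \sum_(i < n.+1) binz R (- n.+1%:Z) i *:
    residue (ser_mul (zhu_kernel (n + i + 1)) (Yexp X u v)).
Proof.
rewrite /star_t Yser_exp (_ : (fun m => _) = fun m =>
    \sum_(i < n.+1) binz R (- n.+1%:Z) i * zhu_kernel (n + i + 1) m).
  exact: (ser_mul_suml _ _ (fun i => zhu_kernel (n + i + 1)) _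
    (Yexp_bounded u v)).
by apply: funext => m; apply: eq_bigr => i _; rewrite kernelE [(i + n)%N]addnC.
Qed.

Lemma residue_kernel_lin q a u1 u2 v :
  residue (ser_mul (zhu_kernel q) (Yexp X (a *: u1 + u2) v)) =
  a *: residue (ser_mul (zhu_kernel q) (Yexp X u1 v)) +
  residue (ser_mul (zhu_kernel q) (Yexp X u2 v)).
Proof.
rewrite Yexp_lin ser_mul_linr//; [exact: laurent_bounded | |];
exact: Yexp_bounded.
Qed.

Lemma circ_t_homogeneous k u v :
  homogeneous X k u -> circ_t K n u v = circ_h X n k u v.
Proof. by move=> uk; rewrite circ_tE (residue_kernel _ _ uk). Qed.

Lemma star_t_homogeneous k u v :
  homogeneous X k u -> star_t K n u v = star_h X n k u v.
Proof.
move=> uk; rewrite star_tE; apply: eq_bigr => i _.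
by rewrite binz_opp (residue_kernel _ _ uk).
Qed.

Lemma circ_tD u1 u2 v :
  circ_t K n (u1 + u2) v = circ_t K n u1 v + circ_t K n u2 v.
Proof. by rewrite !circ_tE -[u1]scale1r residue_kernel_lin !scale1r. Qed.

Lemma star_tD u1 u2 v :
  star_t K n (u1 + u2) v = star_t K n u1 v + star_t K n u2 v.
Proof.
rewrite !star_tE -big_split /=; apply: eq_bigr => i _.
by rewrite -[u1]scale1r residue_kernel_lin !scale1r scalerDr.
Qed.

Lemma star_t0 v : star_t K n 0 v = 0.
Proof. by apply: (@addrI _ (star_t K n 0 v)); rewrite -star_tD !addr0. Qed.

(** Only the weight components of [u] enter the left side; the right side is
    additive, hence determined by its values on them. *)
Lemma starE u v : star X n u v = star_t K n u v.
Proof.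
have : is_weight_decomposition X u (weight_component X u).
  by rewrite /weight_component; case: xgetP => // /(_ _) nof;
    have [f fu] := voa_grading hX u; case: (nof f).
set f := weight_component X u => -[ffin fh fu].
have -> : star X n u v = \sum_(k \in [set: int]) star_t K n (f k) v.
  by apply: eq_fsbigr => k _; rewrite (star_t_homogeneous _ (fh k)).
have /finite_seqP[s fsE] := ffin.
have fs k : k \notin undup s -> f k = 0.
  rewrite mem_undup => /negP ks; apply: contrapT => fk; apply: ks.
  by have : [set k | f k <> 0] k by []; rewrite fsE.
rewrite (fsumT_seq (s := undup s)) ?undup_uniq//; last first.
  by move=> k /fs ->; rewrite star_t0.
rewrite -(big_morph (fun u => star_t K n u v) (fun u1 u2 => star_tD u1 u2 v)
  (star_t0 v)); congr (star_t K n _ v).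
by rewrite [RHS]fu (fsumT_seq (s := undup s)) ?undup_uniq.
Qed.

End Products.

(** On a vector [v] of weight [k] the series [Y[v,x]1] is
    [e^(k x) (v + (e^x - 1) L(-1)v + ...)], by the creation property; its
    coefficient at [x] is [k v + L(-1)v]. *)
Lemma Dop_exp v : Dop (exp_voa X c) v = Lop X (-1) v + Lop X 0 v.
Proof.
have -> : Dop (exp_voa X c) v = Yexp X v (vac X) 1.
  by rewrite /Dop /ser_deriv Yser_exp add0r scale1r.
elim/weight_ind: v => [k v vk|v1 v2 IH1 IH2].
  rewrite (Yexp_homogeneous _ vk) /subst.
  have Yneg p : p < 0 -> Yser X v (vac X) p = 0.
    by move=> p0; apply: (va_creation hV); lia.
  rewrite (fsumT_seq (s := [:: 1; 0])) //; last first.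
    move=> p; rewrite !inE negb_or => /andP[p1 p0].
    have [pneg|ppos] := ltP p 0; first by rewrite Yneg ?scaler0.
    rewrite (orderM (@order_exp _ _) (@order_expm1z _ p)) ?scale0r//; lia.
  rewrite big_cons big_seq1 expr1z expr0z mulr1.
  rewrite (lcoefM_lead (M := 0) (N := 1) (@order_exp _ _) (@order_expm1 _)).
  rewrite expm1_lead /= expr0 expr1 fact0 !divr1 mulr1 scale1r.
  rewrite (voa_translation hX); congr (_ + _).
  by rewrite [RHS]vk /Yser (va_creation_lim hV).
rewrite -[v1]scale1r Yexp_lin !scale1r IH1 IH2.
by rewrite -[v1 in RHS]scale1r !Lop_lin !scale1r addrACA.
Qed.

Lemma span_subspace (A : set V) : subspace (Defs.span A).
Proof.
split=> [B [[B0 _] _]|a u v Au Av B BA]; first exact: B0.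
by apply: BA.1.2; [exact: Au|exact: Av].
Qed.

(** The generators of either subspace are generators of the other one, except
    that [circ_t u v] with [u] not homogeneous is a sum of such. *)
Lemma O_nE n : O_n X n = Otilde_n (exp_voa X c) n.
Proof.
have OD (A : set V) u v : Defs.span A u -> Defs.span A v -> Defs.span A (u + v).
  by move=> Au Av; rewrite -[u]scale1r; apply: (span_subspace A).2.
apply/seteqP; split; apply: smallest_sub; try exact: span_subspace.
  move=> _ [[v _ <-]|[k [u [v [uk ->]]]]]; apply: sub_gen_smallest.
    by left; exists v; rewrite ?Dop_exp.
  by right; exists u, v; rewrite (circ_t_homogeneous _ _ uk).
move=> _ [[v _ <-]|[u [v ->]]].
  by apply: sub_gen_smallest; left; exists v; rewrite ?Dop_exp.
elim/weight_ind: u => [k u uk|u1 u2 IH1 IH2].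
  apply: sub_gen_smallest; right; exists k, u, v.
  by rewrite (circ_t_homogeneous _ _ uk).
by rewrite circ_tD; exact: OD.
Qed.

End VertexOperatorAlgebra.

Theorem mainTheorem7 (R : realType) (V : lmodType R[i]) (X : voa_data V)
    (c : R[i]) (hX : is_voa X c) (n : nat) :
  A_n X n = Atilde_n (exp_voa X c) n.
Proof.
rewrite /A_n /Atilde_n (O_nE hX); congr (quotient_by _ _ _).
by apply: funext => u; apply: funext => v; exact: starE.
Qed.
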